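(* Let $r\ge 1$, let $A$ be a real $r\times r$ matrix and let $R,S$ be real symmetric positive semi-definite $r\times r$ matrices such that $(A,R^{1/2})$ is controllable and $(A,S^{1/2})$ is observable. Then for any integer $n\geq r$ and any $P\in\mathcal{S}^0_r$, $$\Phi_n(P)=P_{\infty}+E^n\,\mathcal{L}_n(P)^{-1}(P-P_{\infty})\,(E^{n})^{\prime},$$ where $\mathcal{L}_n(P):=I+(P-P_\infty)G_n$.
   Context: All matrices are real $r\times r$; $M'$ denotes the transpose of $M$. $\mathcal{S}^0_r$ is the set of symmetric positive semi-definite matrices. $R^{1/2}$, $S^{1/2}$ are symmetric square roots of $R,S$. Controllability of $(A,R^{1/2})$ means that $[R^{1/2},AR^{1/2},\ldots,A^{r-1}R^{1/2}]$ has rank $r$; observability of $(A,S^{1/2})$ means that the matrix obtained by stacking $S^{1/2},S^{1/2}A,\ldots,S^{1/2}A^{r-1}$ vertically has rank $r$. For $P,Q\in\mathcal{S}^0_r$ the matrix $I+PQ$ is invertible. The Riccati map $\Phi:\mathcal{S}^0_r\to\mathcal{S}^0_r$ is $\Phi(P):=A(I+PS)^{-1}PA'+R$, and $\Phi_n$ is its $n$-fold composition ($\Phi_0$ is the identity map). It is a well-known fact that, when $(A,R^{1/2})$ is controllable and $(A,S^{1/2})$ is observable, $\Phi$ has a unique positive definite fixed point $P_\infty=\Phi(P_\infty)$, and that $E:=A(I+P_\infty S)^{-1}$ has spectral radius strictly less than $1$. Set $F:=S(I+P_\infty S)^{-1}$. The Gramians $G_n$ are defined by $G_0=0$, $G_n=E'G_{n-1}E+F$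 for $n\ge 1$, i.e. $G_n=\sum_{0\le k<n}(E')^kFE^k$. For $n\ge r$ and $P\in\mathcal{S}^0_r$ the matrix $\mathcal{L}_n(P)$ is invertible. *)

(* Defs.v *)
From HB Require Import structures.
From mathcomp Require Export all_boot all_order all_algebra.
From mathcomp Require Export reals.

Set Implicit Arguments.
Unset Strict Implicit.
Unset Printing Implicit Defensive.

Import Order.TTheory GRing.Theory Num.Theory.
Local Open Scope ring_scope.

Section RiccatiDefs.
Variables (K : realType) (r : nat).
Implicit Types A R S P Pinf : 'M[K]_r.

Definition psdmx P : Prop :=
  P^T = P /\ forall x : 'cV[K]_r, 0 <= (x^T *m P *m x) 0 0.

Definition pdmx P : Prop :=
  P^T = P /\ forall x : 'cV[K]_r, x != 0 -> 0 < (x^T *m P *m x) 0 0.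

Definition symmetric_sqrt (M Mh : 'M[K]_r) : Prop :=
  Mh^T = Mh /\ Mh *m Mh = M.

Definition controllable A (B : 'M[K]_r) : Prop :=
  \rank (\mxrow_(k < r) (A ^+ k *m B)) = r.

Definition observable A (C : 'M[K]_r) : Prop :=
  \rank (\mxcol_(k < r) (C *m A ^+ k)) = r.

(* invmx returns its argument on singular matrices; for P and S positive
   semi-definite, 1%:M + P *m S is always invertible. *)
Definition riccati A R S P : 'M[K]_r :=
  A *m invmx (1%:M + P *m S) *m P *m A^T + R.

Definition riccati_iter A R S (n : nat) P : 'M[K]_r :=
  iter n (riccati A R S) P.

Definition closed_loop A S Pinf : 'M[K]_r :=
  A *m invmx (1%:M + Pinf *m S).

Definition gramian_incr S Pinf : 'M[K]_r :=
  S *m invmx (1%:M + Pinf *m S).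

Fixpoint gramian A S Pinf (n : nat) : 'M[K]_r :=
  if n is m.+1 then
    (closed_loop A S Pinf)^T *m gramian A S Pinf m *m closed_loop A S Pinf
      + gramian_incr S Pinf
  else 0.

Definition Lmx A S Pinf (n : nat) P : 'M[K]_r :=
  1%:M + (P - Pinf) *m gramian A S Pinf n.

End RiccatiDefs.

(* Main.v *)
Require Import Defs.
From mathcomp Require Import all_boot all_order all_algebra reals.

Set Implicit Arguments.
Unset Strict Implicit.
Unset Printing Implicit Defensive.

Import Order.TTheory GRing.Theory Num.Theory.
Local Open Scope ring_scope.

(** Write D = P - Pinf. Since 1 + PS = (1 + DF)(1 + Pinf S), the Riccati map
    satisfies Phi(P) - Pinf = E (1 + DF)^-1 D E'. Iterating from the first step,
    the push-through identity (1 + XY)^-1 X = X (1 + YX)^-1 with X = E turns the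
    formula at n for Phi(P) into the formula at n+1 for P, and Sylvester's
    criterion carries the invertibility of L_n along. *)

Section Matrices.
Variables (K : fieldType) (r : nat).
Implicit Types X Y : 'M[K]_r.

(** The inverse of 1 + YX is explicit: 1 - Y (1 + XY)^-1 X. It works because (1 + YX) Y = Y (1 +
    XY). *)
Lemma unitmx_1DmulC X Y :
  (1%:M + X *m Y \in unitmx) = (1%:M + Y *m X \in unitmx).
Proof.
wlog suff: X Y / 1%:M + X *m Y \in unitmx -> 1%:M + Y *m X \in unitmx.
  by move=> H; apply/idP/idP; apply: H.
move=> U; set Z := 1%:M - Y *m invmx (1%:M + X *m Y) *m X.
have /mulmx1_unit[] // : (1%:M + Y *m X) *m Z = 1%:M.
have YD : (1%:M + Y *m X) *m Y = Y *m (1%:M + X *m Y).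
  by rewrite mulmxDl mulmxDr mul1mx mulmx1 mulmxA.
by rewrite mulmxBr mulmx1 !mulmxA YD mulmxK // addrK.
Qed.

Lemma invmx_push_through X Y : 1%:M + X *m Y \in unitmx ->
  invmx (1%:M + X *m Y) *m X = X *m invmx (1%:M + Y *m X).
Proof.
move=> U; have V : 1%:M + Y *m X \in unitmx by rewrite -unitmx_1DmulC.
apply: (canRL (mulmxK V)); rewrite -mulmxA; apply: (canLR (mulKmx U)).
by rewrite mulmxDl mulmxDr mul1mx mulmx1 mulmxA.
Qed.

Lemma invmxM X Y : X \in unitmx -> Y \in unitmx ->
  invmx (X *m Y) = invmx Y *m invmx X.
Proof.
move=> UX UY; have U : X *m Y \in unitmx by rewrite unitmx_mul UX.
rewrite -[RHS]mulmx1 -(mulmxV U) [RHS]mulmxA -[X in _ = X *m _]mulmxA.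
by rewrite mulKmx // mulVmx // mul1mx.
Qed.

End Matrices.

Lemma dot_eq0 (K : realDomainType) (r : nat) (x : 'cV[K]_r) :
  (x^T *m x) 0 0 = 0 -> x = 0.
Proof.
rewrite mxE => /eqP; rewrite psumr_eq0 => [/allP x0|i _]; last first.
  by rewrite mxE -expr2 sqr_ge0.
apply/matrixP=> i j; rewrite (ord1 j) !mxE.
have := x0 i (mem_index_enum i).
by rewrite mxE -expr2 /= sqrf_eq0 => /eqP.
Qed.

Section Riccati.
Variables (K : realType) (r : nat) (A R S Sh : 'M[K]_r).
Hypotheses (hR : psdmx R) (hS : psdmx S) (hSh : symmetric_sqrt S Sh).
Implicit Types P : 'M[K]_r.

(** A kernel vector satisfies x = -PSx, so x'Sx = -(Sx)'P(Sx) <= 0. Hence x'Sx = |Sh x|^2 vanishes,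
    which gives Sx = 0 and then x = 0. *)
Lemma unitmx_1Dpsd P : psdmx P -> 1%:M + P *m S \in unitmx.
Proof.
case: hS hSh => ST Sge0 [ShT ShE] [PT Pge0].
(* [det0P] yields a row vector in the left kernel; transposing first makes its transpose a right
   kernel vector of 1 + PS. *)
rewrite -unitmx_tr unitmxE unitfE; apply/det0P => -[v v_neq0].
move=> /(congr1 (@trmx _ _ _)); rewrite trmx_mul trmxK trmx0.
set x := v^T; rewrite mulmxDl mul1mx -mulmxA => /eqP.
rewrite addr_eq0 => /eqP xE.
have : (x^T *m S *m x) 0 0 = 0.
  apply/eqP; rewrite eq_le Sge0 andbT.
  rewrite {2}xE mulmxN mxE oppr_le0.
  by have := Pge0 (S *m x); rewrite trmx_mul ST !mulmxA.
have -> : x^T *m S *m x = (Sh *m x)^T *m (Sh *m x).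
  by rewrite trmx_mul ShT -ShE !mulmxA.
move=> /dot_eq0 Shx; case/eqP: v_neq0; apply: trmx_inj.
by rewrite -/x xE -ShE -mulmxA Shx !mulmx0 oppr0 trmx0.
Qed.

Lemma psdmx_riccati P : psdmx P -> psdmx (riccati A R S P).
Proof.
move=> Ppsd; have U := unitmx_1Dpsd Ppsd.
case: hS hR Ppsd => ST Sge0 [RT Rge0] [PT Pge0].
have UT : (1%:M + P *m S)^T = 1%:M + S *m P.
  by rewrite linearD /= trmx1 trmx_mul ST PT.
have V : 1%:M + S *m P \in unitmx by rewrite -UT unitmx_tr.
have ME := invmx_push_through U.
have MT : (invmx (1%:M + P *m S) *m P)^T = invmx (1%:M + P *m S) *m P.
  by rewrite trmx_mul trmx_inv UT PT.
rewrite /riccati -[A *m _ *m P]mulmxA; split=> [|x].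
  by rewrite linearD /= 2!trmx_mul trmxK MT RT !mulmxA.
rewrite mulmxDr mulmxDl mxE addr_ge0 //.
(* This [y] solves A'x = (1 + SP) y, which turns x'A P (1 + SP)^-1 A'x into y'(1 + PS) P y, a sum of
   two nonnegative quadratic forms. *)
set y := invmx (1%:M + S *m P) *m (A^T *m x).
have AxE : A^T *m x = (1%:M + S *m P) *m y by rewrite mulKVmx.
have -> : x^T *m (A *m (invmx (1%:M + P *m S) *m P) *m A^T) *m x
   = y^T *m P *m y + (P *m y)^T *m S *m (P *m y).
  rewrite ME -!mulmxA -/y (mulmxA x^T) -[x^T *m A]trmxK trmx_mul trmxK AxE.
  rewrite trmx_mul linearD /= trmx1 !trmx_mul ST PT.
  by rewrite mulmxDr mulmx1 mulmxDl !mulmxA.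
by rewrite mxE addr_ge0.
Qed.

Variable Pinf : 'M[K]_r.
Hypotheses (hPinf : psdmx Pinf) (hfix : riccati A R S Pinf = Pinf).

Let E := closed_loop A S Pinf.
Let F := gramian_incr S Pinf.
Let J : 'M[K]_r := 1%:M + Pinf *m S.

(** By the definition of F, F J = S, so the term Pinf S of J cancels against -Pinf F J. *)
Lemma riccati_denominator_factor P :
  1%:M + P *m S = (1%:M + (P - Pinf) *m F) *m J.
Proof.
rewrite mulmxDl mul1mx -mulmxA mulmxKV ?unitmx_1Dpsd //.
by rewrite mulmxBl -addrA subrKC.
Qed.

Lemma unitmx_Lmx1 P : psdmx P -> 1%:M + (P - Pinf) *m F \in unitmx.
Proof.
by move/unitmx_1Dpsd; rewrite riccati_denominator_factor unitmx_mul => /andP[].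
Qed.

Lemma riccati_sub_fixpoint P : psdmx P ->
  riccati A R S P - Pinf =
    E *m invmx (1%:M + (P - Pinf) *m F) *m (P - Pinf) *m E^T.
Proof.
move=> Ppsd; have U := unitmx_1Dpsd Ppsd.
have UJ : J \in unitmx := unitmx_1Dpsd hPinf.
case: hS hPinf => ST _ [QT _].
have JT : J^T = 1%:M + S *m Pinf by rewrite linearD /= trmx1 trmx_mul ST QT.
have UJT : J^T \in unitmx by rewrite unitmx_tr.
have QJT : invmx J *m Pinf = Pinf *m invmx J^T.
  by rewrite JT invmx_push_through.
have -> : E *m invmx (1%:M + (P - Pinf) *m F) = A *m invmx (1%:M + P *m S).
  by rewrite riccati_denominator_factor invmxM ?unitmx_Lmx1 // [RHS]mulmxA.
have -> : E^T = invmx J^T *m A^T by rewrite trmx_mul trmx_inv.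
rewrite -{1}hfix /riccati opprD addrACA subrr addr0 -mulmxBl mulmxA.
congr (_ *m _); rewrite -!mulmxA -mulmxBr QJT; congr (_ *m _).
(* Clearing 1 + PS on the left and J' = 1 + S Pinf on the right leaves P (1 + S Pinf) - (1 + PS)
   Pinf = P - Pinf, where the terms P S Pinf cancel. *)
rewrite -[LHS](mulKmx U) mulmxBr mulKVmx //; congr (_ *m _).
apply: (canRL (mulmxK UJT)); rewrite mulmxBl -!mulmxA mulVmx // mulmx1.
rewrite JT mulmxDr mulmx1 mulmxDl mul1mx !mulmxA.
by rewrite opprD addrACA subrr addr0.
Qed.

Lemma riccati_iter_sub_fixpoint n P : psdmx P ->
  Lmx A S Pinf n P \in unitmx /\
  riccati_iter A R S n P - Pinf =
    E ^+ n *m invmx (Lmx A S Pinf n P) *m (P - Pinf) *m (E ^+ n)^T.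
Proof.
(* P stays general because the induction hypothesis is applied to Phi(P). *)
elim: n P => [|n IH] P Ppsd.
  by rewrite /Lmx /= mulmx0 addr0 invmx1 unitmx1 expr0 trmx1 !mulmx1 mul1mx.
have [] := IH _ (psdmx_riccati Ppsd).
have UL := unitmx_Lmx1 Ppsd.
rewrite /riccati_iter iterSr /Lmx /= -/E -/F riccati_sub_fixpoint //.
clearbody E F.
set G := gramian A S Pinf n; set D := P - Pinf in UL *.
set L := 1%:M + D *m F in UL *.
(* With this [Y], L_n(Phi(P)) = 1 + EY while L_{n+1}(P) = L (1 + YE), so the two differ by a swap of
   factors and the unit L = L_1(P). *)
pose Y := invmx L *m D *m E^T *m G.
have -> : 1%:M + E *m invmx L *m D *m E^T *m G = 1%:M + E *m Y.
  by rewrite !mulmxA.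
have -> : 1%:M + D *m (E^T *m G *m E + F) = L *m (1%:M + Y *m E).
  rewrite [RHS]mulmxDr mulmx1 /Y !mulmxA mulmxV // mul1mx.
  by rewrite [RHS]addrAC -addrA mulmxDr !mulmxA.
clearbody Y; move=> UEY ->.
have UYE : 1%:M + Y *m E \in unitmx by rewrite -unitmx_1DmulC.
rewrite unitmx_mul UL UYE invmxM //; split=> //.
rewrite exprSr -!mulmxE trmx_mul !mulmxA.
(* Pushing E through (1 + EY)^-1 supplies the missing factor of E^(n+1) and leaves (1 + YE)^-1 L^-1,
   the inverse of L_{n+1}(P). *)
by rewrite -[E ^+ n *m _ *m E]mulmxA invmx_push_through // !mulmxA.
Qed.

End Riccati.

Theorem corollary1p4 (K : realType) (r : nat) (hr : (1 <= r)%N)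
  (A R S Rh Sh Pinf : 'M[K]_r)
  (hR : psdmx R) (hS : psdmx S)
  (hRh : symmetric_sqrt R Rh) (hSh : symmetric_sqrt S Sh)
  (hctrl : controllable A Rh) (hobs : observable A Sh)
  (hPinf : pdmx Pinf) (hfix : riccati A R S Pinf = Pinf)
  (n : nat) (hn : (r <= n)%N) (P : 'M[K]_r) (hP : psdmx P) :
  let E := closed_loop A S Pinf in
  Lmx A S Pinf n P \in unitmx /\
  riccati_iter A R S n P =
    Pinf + E ^+ n *m invmx (Lmx A S Pinf n P) *m (P - Pinf) *m (E ^+ n)^T.
Proof.
have Qpsd : psdmx Pinf.
  case: hPinf => QT Qgt0; split=> // x.
  have [->|/Qgt0/ltW//] := eqVneq x 0.
  by rewrite mulmx0 mxE.
have [UL iterE] := riccati_iter_sub_fixpoint hR hS hSh Qpsd hfix n hP.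
by split=> //=; rewrite -iterE subrKC.
Qed.
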